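(* Let $C$ be a field of characteristic zero. Let $L=\sum_{k=0}^{r_L} l_k(x)\partial^k\in C[x][\partial]$ be an operator of order $r_L$ whose coefficients $l_k\in C[x]$ have degree at most $d_L$, and let $P\in C[x,y]$ with $\deg_y P=r_P$, $\deg_x P=d_P$, such that $P$ is square-free as an element of $C(x)[y]$ and has no non-constant divisor in $\bar C[y]$. Let $r,d\in\mathbb N$ be such that \[ r\ge r_Lr_P\quad\text{and}\quad d\ge \frac{r(3r_P+d_L-1)d_Pr_Lr_P}{r+1-r_Lr_P}. \] Then there exists an operator $M\in C[x][\partial]$ of order at most $r$ and degree at most $d$ such that for every solution $g$ of $P$ and every solution $f$ of $L$ the composition $f\circ g$ is a solution of $M$. In particular, there is such an operator $M$ of order $r_Lr_P$ and degree $(3r_P+d_L-1)d_Pr_L^2r_P^2$.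
   Context: $C[x][\partial]$ is the ring of linear differential operators with polynomial coefficients, with $\partial x=x\partial+1$; the degree of an operator is the maximum degree of its polynomial coefficients. $\bar C$ is an algebraic closure of $C$. A solution of $P$ is a $g$ with $P(x,g(x))=0$; a solution of $L$ is an $f$ with $L(f)=0$. Compositions are understood as follows: for every $\alpha\in C$, every solution $g\in C[[x-\alpha]]$ of $P$ and every solution $f\in C[[x-g(\alpha)]]$ of $L$, the composition $f\circ g\in C[[x-\alpha]]$ (for $C=\mathbb C$ this coincides with composition of analytic functions). *)

(* Defs.v *)
From HB Require Import structures.
From mathcomp Require Import all_boot all_order all_algebra.
Set Implicit Arguments. Unset Strict Implicit. Unset Printing Implicit Defensive.
Import Order.TTheory GRing.Theory Num.Theory.
Local Open Scope ring_scope.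

(* Bivariate polynomials P in C[x,y] are elements of {poly {poly C}}:        *)
(* P = \sum_j P`_j(x) y^j (outer variable y, inner variable x).              *)
(* Differential operators L = \sum_k l_k(x) d^k in C[x][d] are represented   *)
(* by their coefficient list, also as an element of {poly {poly C}}          *)
(* (outer variable = d); only the additive structure / coefficients are     *)
(* used, never the (commutative) product of {poly {poly C}}.                 *)

Definition degx (C : fieldType) (P : {poly {poly C}}) : nat :=
  (\max_(j < size P) (size (P`_j)%R).-1)%N.

Definition op_order (C : fieldType) (L : {poly {poly C}}) : nat := (size L).-1.
Definition op_degree (C : fieldType) (L : {poly {poly C}}) : nat :=
  (\max_(k < size L) (size (L`_k)%R).-1)%N.

Definition series (C : fieldType) := nat -> C.

Definition ps_one (C : fieldType) : series C := fun n => (n == 0%N)%:R.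
Definition ps_mul (C : fieldType) (f g : series C) : series C :=
  fun n => \sum_(i < n.+1) f i * g (n - i)%N.
Definition ps_exp (C : fieldType) (f : series C) (k : nat) : series C :=
  iter k (ps_mul f) (ps_one C).
Definition ps_deriv (C : fieldType) (f : series C) : series C :=
  fun n => f n.+1 *+ n.+1.
Definition ps_derivn (C : fieldType) (k : nat) (f : series C) : series C :=
  iter k (@ps_deriv C) f.

(* a polynomial q(x) expanded at x = a, i.e. as an element of C[[x - a]] *)
Definition poly_at (C : fieldType) (q : {poly C}) (a : C) : series C :=
  fun n => (q \Po ('X + a%:P))`_n.

Definition apply_op (C : fieldType) (L : {poly {poly C}}) (a : C) (f : series C)
  : series C :=
  fun n => \sum_(k < size L) ps_mul (poly_at L`_k a) (ps_derivn k f) n.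

Definition is_op_sol (C : fieldType) (L : {poly {poly C}}) (a : C) (f : series C) :=
  forall n, apply_op L a f n = 0.

Definition eval_bivar (C : fieldType) (P : {poly {poly C}}) (a : C) (g : series C)
  : series C :=
  fun n => \sum_(j < size P) ps_mul (poly_at P`_j a) (ps_exp g j) n.

Definition is_alg_sol (C : fieldType) (P : {poly {poly C}}) (a : C) (g : series C) :=
  forall n, eval_bivar P a g n = 0.

(* composition f o g, for g in C[[x - a]] and f in C[[x - g(a)]], g(a) = g 0:
   f o g = \sum_k f_k (g - g(a))^k, a finite sum coefficientwise *)
Definition ps_comp (C : fieldType) (f g : series C) : series C :=
  fun n => \sum_(k < n.+1)
             f k * ps_exp (fun m => if m == 0%N then 0 else g m) k n.

Definition squarefree_Cx (C : fieldType) (P : {poly {poly C}}) : Prop :=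
  forall Q R : {poly {fraction {poly C}}},
    map_poly (@tofrac _) P = Q * Q * R -> (size Q <= 1)%N.

Definition is_alg_closure (C : fieldType) (K : closedFieldType)
  (iota : {rmorphism C -> K}) : Prop :=
  forall z : K, exists p : {poly C}, p != 0 /\ root (map_poly iota p) z.

Definition no_y_divisor (C : fieldType) (K : closedFieldType)
  (iota : {rmorphism C -> K}) (P : {poly {poly C}}) : Prop :=
  forall (Q : {poly K}) (R : {poly {poly K}}),
    map_poly (map_poly iota) P = map_poly polyC Q * R -> (size Q <= 1)%N.

(* Main.v *)
Require Import Defs.
From HB Require Import structures.
From mathcomp Require Import all_boot all_order all_algebra.
From mathcomp Require Import boolp separable ring zify.
Import Order.TTheory GRing.Theory Num.Theory.
Local Open Scope ring_scope.

Set Implicit Arguments.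
Unset Strict Implicit.
Unset Printing Implicit Defensive.

(* Along a root g of P one has P_y g' = - P_x, and L rewrites l(g) f^(r_L)(g),
   with l the leading coefficient of L, in terms of the lower f^(j)(g).  Hence
   (f o g)^(n) is a combination of the r_L functions f^(j)(g), j < r_L, whose
   coefficients are polynomials in x and g over the n-th power of
   U = P_y s l(g), with s = P_y or s = 1.  After multiplication by U^r and a
   power of the leading coefficient of P, reduction modulo P turns the condition
   sum_n c_n(x) (f o g)^(n) = 0 into r_L r_P polynomial equations of degree at
   most d + r (3 r_P + d_L - 1) d_P in x.  The bound on d guarantees that this
   linear system over C has more unknowns than equations.  The operator found
   kills f o g because U does not vanish at g: P_y(x, g) <> 0 since P is
   square-free, and l(g) = 0 would force g to be a constant c, so that y - c
   would divide P. *)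

(* A copy of [series C] carrying the Cauchy product: the plain function type
   [nat -> C] is reserved for pointwise structures. *)
Definition fps (C : fieldType) : Type := series C.

HB.instance Definition _ (C : fieldType) := gen_eqMixin (fps C).
HB.instance Definition _ (C : fieldType) := gen_choiceMixin (fps C).

(** * The ring of formal power series *)

Section FpsRing.
Variable C : fieldType.
Implicit Types f g h : fps C.

Definition fps_zero : fps C := fun=> 0.
Definition fps_opp f : fps C := fun n => - f n.
Definition fps_add f g : fps C := fun n => f n + g n.

Fact fps_addA : associative fps_add.
Proof. by move=> f g h; apply/funext => n; rewrite /fps_add addrA. Qed.
Fact fps_addC : commutative fps_add.
Proof. by move=> f g; apply/funext => n; rewrite /fps_add addrC. Qed.
Fact fps_add0 : left_id fps_zero fps_add.
Proof. by move=> f; apply/funext => n; rewrite /fps_add add0r. Qed.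
Fact fps_addN : left_inverse fps_zero fps_opp fps_add.
Proof. by move=> f; apply/funext => n; rewrite /fps_add addNr. Qed.

HB.instance Definition _ :=
  GRing.isZmodule.Build (fps C) fps_addA fps_addC fps_add0 fps_addN.

(** Coefficient [n] of a Cauchy product involves only indices up to [n], so associativity and
    commutativity are inherited from polynomials. *)
Lemma ps_mul_trunc f g n N : (n < N)%N ->
  ps_mul f g n = (\poly_(i < N) f i * \poly_(i < N) g i)`_n.
Proof.
move=> ltnN; rewrite coefM; apply: eq_bigr => i _.
by have := ltn_ord i => ile; rewrite !coef_poly !ifT //; lia.
Qed.

Lemma coefM_congr (p p' q q' : {poly C}) n :
  (forall i, (i <= n)%N -> p`_i = p'`_i) ->
  (forall i, (i <= n)%N -> q`_i = q'`_i) -> (p * q)`_n = (p' * q')`_n.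
Proof.
move=> Ep Eq; rewrite !coefM; apply: eq_bigr => i _.
by have := ltn_ord i => ile; rewrite Ep ?Eq //; lia.
Qed.

Fact fps_mulA : associative (@ps_mul C : fps C -> fps C -> fps C).
Proof.
move=> f g h; apply/funext => n; rewrite !(@ps_mul_trunc _ _ n n.+1) //.
transitivity (\poly_(i < n.+1) f i *
  (\poly_(i < n.+1) g i * \poly_(i < n.+1) h i))`_n.
  apply: coefM_congr => // i ile.
  by rewrite coef_poly ltnS ile (@ps_mul_trunc _ _ i n.+1).
rewrite mulrA; apply: coefM_congr => // i ile.
by rewrite coef_poly ltnS ile (@ps_mul_trunc _ _ i n.+1).
Qed.

Fact fps_mulC : commutative (@ps_mul C : fps C -> fps C -> fps C).
Proof.
by move=> f g; apply/funext => n; rewrite !(@ps_mul_trunc _ _ n n.+1) // mulrC.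
Qed.

Fact fps_mul1 : left_id (@ps_one C : fps C) (@ps_mul C).
Proof.
move=> f; apply/funext => n; rewrite /ps_mul big_ord_recl /= mul1r subn0.
by rewrite big1 ?addr0 // => i _; rewrite mul0r.
Qed.

Fact fps_mulDl : left_distributive (@ps_mul C : fps C -> fps C -> fps C) +%R.
Proof.
move=> f g h; apply/funext => n; rewrite [RHS]/GRing.add /= /fps_add /ps_mul.
by rewrite -big_split; apply: eq_bigr => i _; rewrite /= -mulrDl.
Qed.

Fact fps_one_neq0 : (@ps_one C : fps C) != 0.
Proof. by apply/eqP => /(congr1 (fun f : fps C => f 0%N)) /eqP; rewrite oner_eq0. Qed.

HB.instance Definition _ := GRing.Zmodule_isComNzRing.Build (fps C)
  fps_mulA fps_mulC fps_mul1 fps_mulDl fps_one_neq0.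

Lemma fpsP f g : (forall n, f n = g n) -> f = g. Proof. exact: funext. Qed.

Lemma fpsDE f g n : (f + g) n = f n + g n. Proof. by []. Qed.
Lemma fpsNE f n : (- f) n = - f n. Proof. by []. Qed.
Lemma fps0E n : (0 : fps C) n = 0. Proof. by []. Qed.
Lemma fpsME f g n : (f * g) n = \sum_(i < n.+1) f i * g (n - i)%N.
Proof. by []. Qed.

Lemma fps_sumE (I : Type) (s : seq I) (Q : pred I) (F : I -> fps C) n :
  (\sum_(i <- s | Q i) F i) n = \sum_(i <- s | Q i) F i n.
Proof. by elim/big_rec2: _ => // i x y _ <-. Qed.

Lemma ps_expE f k : ps_exp f k = (f : fps C) ^+ k.
Proof. by elim: k => // k IH; rewrite exprS -IH. Qed.

Lemma fpsM_congr f g h h' n : (forall i, (i <= n)%N -> f i = g i) ->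
  (forall i, (i <= n)%N -> h i = h' i) -> (f * h) n = (g * h') n.
Proof.
move=> Ef Eh; rewrite !fpsME; apply: eq_bigr => i _.
by have := ltn_ord i => ile; rewrite Ef ?Eh //; lia.
Qed.

(** The lowest non-zero coefficients, at indices [m] and [n], multiply to the coefficient of [f * g]
    at [m + n]. *)
Lemma fps_mulf_eq0 f g : f * g = 0 -> f = 0 \/ g = 0.
Proof.
move=> fg0; have [->|f0] := eqVneq f 0; first by left.
have [->|g0] := eqVneq g 0; [by right | exfalso].
have exnz (e : fps C) : e != 0 -> exists n, e n != 0.
  move=> e0; apply: contrapT => /forallNP H; move/eqP: e0; apply.
  by apply: fpsP => n; apply/eqP/negPn/negP/H.
have [m fm mmin] := ex_minnP (exnz _ f0); have [n gn nmin] := ex_minnP (exnz _ g0).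
have lt_f0 i : (i < m)%N -> f i = 0.
  by move=> lt; apply/eqP/negPn/negP => /mmin; rewrite leqNgt lt.
have lt_g0 i : (i < n)%N -> g i = 0.
  by move=> lt; apply/eqP/negPn/negP => /nmin; rewrite leqNgt lt.
have ltm : (m < (m + n).+1)%N by lia.
have := congr1 (fun h : fps C => h (m + n)%N) fg0.
rewrite /= fpsME (bigD1 (Ordinal ltm)) //= addKn big1 => [|i neqi].
  by rewrite addr0; apply/eqP; rewrite mulf_neq0.
case: (ltnP i m) => [/lt_f0 ->|le]; first by rewrite mul0r.
rewrite lt_g0 ?mulr0 //; move: neqi; rewrite -val_eqE /=; move: (ltn_ord i); lia.
Qed.

Lemma fps_exp_neq0 f n : f != 0 -> f ^+ n != 0.
Proof.
move=> f0; elim: n => [|n IH]; first exact: oner_neq0.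
rewrite exprS; apply/eqP => /fps_mulf_eq0 [] /eqP; exact/negP.
Qed.

Definition cst (c : C) : fps C := fun n => if n == 0%N then c else 0.

Lemma cstME c f n : (cst c * f) n = c * f n.
Proof.
rewrite fpsME big_ord_recl /= subn0 big1 ?addr0 // => i _.
by rewrite /cst /= mul0r.
Qed.

Fact cst_zmod : zmod_morphism cst.
Proof.
by move=> x y; apply: fpsP => -[|n]; rewrite fpsDE fpsNE /cst //= subr0.
Qed.

Fact cst_monoid : monoid_morphism cst.
Proof.
split=> [|x y]; first by apply: fpsP => -[|n].
by apply: fpsP => n; rewrite cstME /cst; case: eqP; rewrite ?mulr0.
Qed.

HB.instance Definition _ := GRing.isZmodMorphism.Build C (fps C) cst cst_zmod.
HB.instance Definition _ := GRing.isMonoidMorphism.Build C (fps C) cst cst_monoid.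

Definition fps_of_poly (a : C) (q : {poly C}) : fps C := poly_at q a.

Fact fps_of_poly_zmod a : zmod_morphism (fps_of_poly a).
Proof.
by move=> p q; apply: fpsP => n; rewrite fpsDE fpsNE /fps_of_poly /poly_at rmorphB coefB.
Qed.

Fact fps_of_poly_monoid a : monoid_morphism (fps_of_poly a).
Proof.
split=> [|p q]; apply: fpsP => n; rewrite /fps_of_poly /poly_at.
  by rewrite rmorph1 coef1.
by rewrite rmorphM coefM.
Qed.

HB.instance Definition _ a :=
  GRing.isZmodMorphism.Build {poly C} (fps C) (fps_of_poly a) (fps_of_poly_zmod a).
HB.instance Definition _ a :=
  GRing.isMonoidMorphism.Build {poly C} (fps C) (fps_of_poly a) (fps_of_poly_monoid a).

Lemma fps_of_polyC a c : fps_of_poly a c%:P = cst c.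
Proof.
by apply: fpsP => n; rewrite /fps_of_poly /poly_at comp_polyC coefC.
Qed.

Lemma fps_of_poly_inj a q : fps_of_poly a q = 0 -> q = 0.
Proof.
move=> q0; have q0' : q \Po ('X + a%:P) = 0.
  by apply/polyP => n; rewrite coef0; exact: (congr1 (fun f : fps C => f n) q0).
have -> : q = (q \Po ('X + a%:P)) \Po ('X - a%:P).
  by rewrite -comp_polyA comp_polyD comp_polyX comp_polyC subrK comp_polyXr.
by rewrite q0' comp_poly0.
Qed.

(** * Derivation of power series *)

Definition dfps f : fps C := ps_deriv f.

Fact dfps_zmod : zmod_morphism dfps.
Proof.
move=> f g; apply: fpsP => n.
by rewrite fpsDE fpsNE /dfps /ps_deriv fpsDE fpsNE mulrnBl.
Qed.

HB.instance Definition _ := GRing.isZmodMorphism.Build (fps C) (fps C) dfps dfps_zmod.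

Lemma dfpsM f g : dfps (f * g) = dfps f * g + f * dfps g.
Proof.
apply: fpsP => n; rewrite fpsDE.
have derE (h : fps C) i : (i <= n)%N -> dfps h i = (\poly_(i < n.+2) h i)^`()`_i.
  by move=> ile; rewrite coef_deriv coef_poly ltnS ltnS ile.
have trE (h : fps C) i : (i <= n)%N -> h i = (\poly_(i < n.+2) h i)`_i.
  by move=> ile; rewrite coef_poly ltnS (leq_trans ile).
have -> : dfps (f * g) n = (\poly_(i < n.+2) f i * \poly_(i < n.+2) g i)^`()`_n.
  by rewrite coef_deriv -(@ps_mul_trunc f g).
rewrite derivM coefD !fpsME !coefM.
congr (_ + _); apply: eq_bigr => i _; have := ltn_ord i => ile.
  by congr (_ * _); symmetry; [apply: derE | apply: trE]; lia.
by congr (_ * _); symmetry; [apply: trE | apply: derE]; lia.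
Qed.

Lemma dfps_cst c : dfps (cst c) = 0.
Proof. by apply: fpsP => n; rewrite /dfps /ps_deriv /cst mul0rn. Qed.

Lemma dfps1 : dfps 1 = 0.
Proof. by rewrite -(rmorph1 cst) dfps_cst. Qed.

Lemma dfps_of_poly a q : dfps (fps_of_poly a q) = fps_of_poly a q^`().
Proof.
apply: fpsP => n; rewrite /dfps /fps_of_poly /poly_at /ps_deriv -coef_deriv.
by rewrite deriv_comp derivD derivX derivC addr0 mulr1.
Qed.

Lemma dfpsX f n : dfps (f ^+ n) = f ^+ n.-1 * dfps f *+ n.
Proof.
elim: n => [|n IH]; first by rewrite dfps1.
rewrite exprS dfpsM IH; case: n {IH} => [|n] /=; first by rewrite mulr0n; ring.
by rewrite !exprS !mulrS; ring.
Qed.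

(** Total derivative: the coefficients of [p] are themselves series, which accounts for the first
    summand. *)
Lemma dfps_horner (p : {poly fps C}) g :
  dfps p.[g] = (map_poly dfps p).[g] + p^`().[g] * dfps g.
Proof.
elim/poly_ind: p => [|p c IH].
  by rewrite map_poly0 deriv0 !horner0 raddf0 mul0r addr0.
have -> : map_poly dfps (p * 'X + c%:P) = map_poly dfps p * 'X + (dfps c)%:P.
  apply/polyP => i; rewrite coef_map coefD [RHS]coefD !coefMX !coefC.
  by case: i => [|i]; rewrite /= ?add0r // !addr0 coef_map.
rewrite derivMXaddC !hornerE raddfD /= dfpsM IH; ring.
Qed.

Lemma dfps_eq0 : [pchar C] =i pred0 -> forall f, dfps f = 0 -> f = cst (f 0%N).
Proof.
move=> /pcharf0P charC f df0; apply: fpsP => -[|n] //.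
have /eqP := congr1 (fun h : fps C => h n) df0.
by rewrite /dfps /ps_deriv fps0E -mulr_natr mulf_eq0 charC orbF => /eqP ->.
Qed.

(** * Composition of power series *)

Definition comp_fps f g : fps C := ps_comp f g.

(** Without constant term, its [k]-th power starts at index [k]; hence the sum in [ps_comp] may stop
    at [n]. *)
Definition fps_shift g : fps C := g - cst (g 0%N).

Lemma fps_shiftE g : (fun m => if m == 0%N then 0 else g m) = fps_shift g.
Proof. by apply: fpsP => -[|n]; rewrite /fps_shift fpsDE fpsNE /cst /= ?subrr ?subr0. Qed.

Lemma exp_fps_shift_lt g k n : (n < k)%N -> (fps_shift g ^+ k) n = 0.
Proof.
elim: k n => // k IH n ltnk; rewrite exprS fpsME big1 // => -[[|i] ilt] _ /=.
  by rewrite /fps_shift fpsDE fpsNE subrr mul0r.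
by rewrite IH ?mulr0 //; lia.
Qed.

(* Modulo [(x - a) ^ n.+1], composition is evaluation of a truncation. *)
Lemma comp_fps_horner f g (p : {poly C}) n : (forall i, (i <= n)%N -> p`_i = f i) ->
  comp_fps f g n = (map_poly cst p).[fps_shift g] n.
Proof.
move=> Ep; have szp : (size (map_poly cst p) <= maxn (size p) n.+1)%N.
  by rewrite (leq_trans (size_poly _ _)) // leq_maxl.
rewrite (horner_coef_wide _ szp) fps_sumE /comp_fps /ps_comp fps_shiftE.
under eq_bigr do rewrite ps_expE.
rewrite -(big_mkord xpredT (fun k => f k * (fps_shift g ^+ k) n)).
under [RHS]eq_bigr do rewrite coef_map cstME.
rewrite -(big_mkord xpredT (fun k => p`_k * (fps_shift g ^+ k) n)) /=.
rewrite [RHS](big_cat_nat (n := n.+1)) ?leq_maxr //=.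
rewrite [X in _ = _ + X]big_nat_cond [X in _ = _ + X]big1 ?addr0.
  by rewrite !big_nat; apply: eq_bigr => i /andP[_ ile]; rewrite Ep.
by move=> i /andP[/andP[lt _] _]; rewrite exp_fps_shift_lt ?mulr0.
Qed.

Definition fps_trunc f n : {poly C} := \poly_(i < n.+1) f i.

Lemma fps_truncE f n i : (i <= n)%N -> (fps_trunc f n)`_i = f i.
Proof. by move=> ile; rewrite coef_poly ltnS ile. Qed.

Lemma comp_fpsM f h g : comp_fps (f * h) g = comp_fps f g * comp_fps h g.
Proof.
apply: fpsP => n.
(* The product of truncations agrees with [f * h] up to index [n], and polynomial evaluation is
   multiplicative. *)
rewrite (@comp_fps_horner _ _ (fps_trunc f n * fps_trunc h n)) => [|i ile]; last first.
  rewrite coefM; apply: eq_bigr => j _; have := ltn_ord j => jle.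
  by rewrite !fps_truncE //; lia.
rewrite rmorphM hornerM; apply: fpsM_congr => i ile; symmetry;
  apply: comp_fps_horner => j jle; rewrite fps_truncE //; lia.
Qed.

Lemma comp_fps_sum (I : Type) (s : seq I) (F : I -> fps C) g :
  comp_fps (\sum_(i <- s) F i) g = \sum_(i <- s) comp_fps (F i) g.
Proof.
apply: fpsP => n; rewrite fps_sumE /comp_fps /ps_comp.
under eq_bigr do rewrite fps_sumE mulr_suml.
exact: exchange_big.
Qed.

Lemma comp_fps0 g : comp_fps 0 g = 0.
Proof.
by apply: fpsP => n; rewrite /comp_fps /ps_comp big1 // => i _; rewrite mul0r.
Qed.

Lemma dfps_comp f g : dfps (comp_fps f g) = comp_fps (dfps f) g * dfps g.
Proof.
apply: fpsP => n; pose p := fps_trunc f n.+1.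
have -> : dfps (comp_fps f g) n = dfps (map_poly cst p).[fps_shift g] n.
  by rewrite /dfps /ps_deriv (@comp_fps_horner _ _ p) // => i; apply: fps_truncE.
rewrite dfps_horner.
have -> : map_poly dfps (map_poly cst p) = 0.
  by apply/polyP => i; rewrite !coef_map /= dfps_cst coef0.
rewrite horner0 add0r deriv_map raddfB /= dfps_cst subr0.
apply: fpsM_congr => // i ile; symmetry; apply: comp_fps_horner => j jle.
by rewrite coef_deriv fps_truncE //; lia.
Qed.

(** The translation by g(a) in the expansion of [q] cancels the one in [fps_shift g]. *)
Lemma comp_fps_of_poly q g :
  comp_fps (fps_of_poly (g 0%N) q) g = (map_poly cst q).[g].
Proof.
apply: fpsP => n.
rewrite (@comp_fps_horner _ _ (q \Po ('X + (g 0%N)%:P))) //.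
rewrite map_comp_poly horner_comp rmorphD /= map_polyX map_polyC !hornerE.
by rewrite /fps_shift subrK.
Qed.

End FpsRing.

(** * Evaluation of bivariate polynomials at a series *)

Section Evaluation.
Variable C : fieldType.
Implicit Types (P Q L : {poly {poly C}}) (f g : fps C).

Definition biev (a : C) g Q : fps C := (map_poly (fps_of_poly a) Q).[g].

Lemma bievB a g P Q : biev a g (P - Q) = biev a g P - biev a g Q.
Proof. by rewrite /biev rmorphB hornerD hornerN. Qed.
Lemma bievD a g P Q : biev a g (P + Q) = biev a g P + biev a g Q.
Proof. by rewrite /biev rmorphD hornerD. Qed.
Lemma bievM a g P Q : biev a g (P * Q) = biev a g P * biev a g Q.
Proof. by rewrite /biev rmorphM hornerM. Qed.
Lemma bievMn a g P n : biev a g (P *+ n) = biev a g P *+ n.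
Proof. by rewrite /biev rmorphMn hornerMn. Qed.
Lemma bievX a g P n : biev a g (P ^+ n) = biev a g P ^+ n.
Proof. by rewrite /biev rmorphXn horner_exp. Qed.
Lemma biev0 a g : biev a g 0 = 0. Proof. by rewrite /biev map_poly0 horner0. Qed.
Lemma biev1 a g : biev a g 1 = 1. Proof. by rewrite /biev rmorph1 hornerC. Qed.

(** The partial derivative in x; the formal derivative in the outer variable is the one in y. *)
Definition derx Q : {poly {poly C}} := map_poly (@deriv C) Q.

Lemma bievC a g q : biev a g q%:P = fps_of_poly a q.
Proof. by rewrite /biev map_polyC hornerC. Qed.

Lemma biev_polyC a g q : biev a g (map_poly polyC q) = (map_poly (@cst C) q).[g].
Proof.
rewrite /biev; congr (_.[_]); apply/polyP => i.
by rewrite !coef_map /= fps_of_polyC.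
Qed.

Lemma dfps_biev a g Q :
  dfps (biev a g Q) = biev a g (derx Q) + biev a g Q^`() * dfps g.
Proof.
rewrite /biev dfps_horner deriv_map; congr (_.[_] + _).
by apply/polyP => i; rewrite !coef_map /= dfps_of_poly.
Qed.

Lemma eval_bivarE P a g : eval_bivar P a g = biev a g P.
Proof.
have szP : (size (map_poly (fps_of_poly a) P) <= size P)%N by exact: size_poly.
apply: fpsP => n; rewrite /biev (horner_coef_wide _ szP) fps_sumE /eval_bivar.
by apply: eq_bigr => i _; rewrite coef_map ps_expE.
Qed.

Lemma apply_opE L a f :
  apply_op L a f = \sum_(k < size L) fps_of_poly a L`_k * iter k (@dfps C) f.
Proof. by apply: fpsP => n; rewrite fps_sumE. Qed.

End Evaluation.

(** * Derivatives of f o g over a common denominator *)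

Section Numerators.
Variables (C : fieldType) (P L s T : {poly {poly C}}) (m : nat).

(** The Jacobian of Q and P: since P_y g' = -P_x at a root g of P, it evaluates there to P_y times
    the derivative of Q(x, g). *)
Definition delta (Q : {poly {poly C}}) := derx Q * P^`() - Q^`() * derx P.

(* The leading coefficient of [L], of order [m.+1], with [y] substituted for [x]. *)
Definition lcy : {poly {poly C}} := map_poly polyC L`_m.+1.

(* The [n]-th derivative of [f o g] is a combination of the [f^(j) o g], [j <= m],
   with coefficients [num n j / denom ^+ n] taken at [y = g]. *)
Definition denom := P^`() * s * lcy.
(** The derivative of [denom] along a root of P, where [T] stands for that of P_y s; in the
    derivative of l(g), the factor P_y g' has become -P_x. *)
Definition ddenom := T * lcy - s * derx P * lcy^`().

Fixpoint num n (j : nat) : {poly {poly C}} :=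
  if n is n'.+1 then
    s * lcy * delta (num n' j) - ddenom * num n' j *+ n'
    - (if j is j'.+1 then s * lcy * derx P * num n' j' else 0)
    + s * derx P * map_poly polyC L`_j * num n' m
  else (j == 0%N)%:R.

Variables (a : C) (f g : fps C).
Hypothesis Pg0 : biev a g P = 0.
Hypothesis Lf0 : is_op_sol L (g 0%N) f.
Hypothesis sizeL : size L = m.+2.
Hypothesis evT : biev a g T = dfps (biev a g (P^`() * s)).

Local Notation ev := (biev a g).
Local Notation g' := (dfps g).
Local Notation F j := (comp_fps (iter j (@dfps C) f) g).

Lemma biev_deriv_root : ev P^`() * g' = - ev (derx P).
Proof.
have := dfps_biev a g P; rewrite Pg0 raddf0 => /esym/eqP.
by rewrite addrC addr_eq0 => /eqP.
Qed.

Lemma biev_delta Q : ev P^`() * dfps (ev Q) = ev (delta Q).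
Proof.
rewrite dfps_biev /delta bievB !bievM mulrDr mulrCA biev_deriv_root; ring.
Qed.

Lemma dfps_denom : dfps (ev denom) = ev ddenom.
Proof.
rewrite /denom /ddenom bievM dfpsM -evT dfps_biev.
have -> : derx lcy = 0.
  by apply/polyP => i; rewrite !coef_map /= derivC coef0.
rewrite biev0 add0r bievB !bievM.
transitivity (ev T * ev lcy + ev s * ev lcy^`() * (ev P^`() * g')); first by ring.
by rewrite biev_deriv_root; ring.
Qed.

Lemma op_sol_comp : \sum_(k < m.+2) ev (map_poly polyC L`_k) * F k = 0.
Proof.
have Lf : apply_op L (g 0%N) f = 0 :> fps C by apply: fpsP => n; apply: Lf0.
have := congr1 (fun h => comp_fps h g) Lf.
rewrite /= comp_fps0 apply_opE comp_fps_sum sizeL => L0; rewrite -[RHS]L0.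
by apply: eq_bigr => k _; rewrite comp_fpsM comp_fps_of_poly biev_polyC.
Qed.

(** Differentiating the previous identity gives the four terms of [num n.+1 j]: the derivative of
    the numerator, that of the power of [denom], the chain rule for f^(j-1) o g, and the rewriting
    of f^(m+1) o g by L. *)
Lemma denom_iter_deriv n :
  ev denom ^+ n * iter n (@dfps C) (comp_fps f g) = \sum_(j < m.+1) ev (num n j) * F j.
Proof.
elim: n => [|n IH].
  rewrite mul1r big_ord_recl /= biev1 mul1r big1 ?addr0 // => i _.
  by rewrite biev0 mul0r.
set h := iter n _ _ in IH *; set S := \sum_(j < _) _ in IH.
(* The product rule for [ev denom ^+ n * h], multiplied by [ev denom]. *)
have -> : ev denom ^+ n.+1 * iter n.+1 (@dfps C) (comp_fps f g) =
    ev denom * dfps S - ev ddenom * S *+ n.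
  rewrite -IH dfpsM dfpsX dfps_denom exprS iterS -/h.
  move: (dfps h) (h) (ev denom) (ev ddenom) => h1 h0 x y.
  by case: n {IH h S} => [|n] /=; [rewrite !mulr0n | rewrite exprS]; ring.
have Uder j : ev denom * dfps (ev (num n j) * F j) =
    ev (s * lcy * delta (num n j)) * F j
    - ev (s * lcy * derx P * num n j) * F j.+1.
  rewrite dfpsM dfps_comp /denom !bievM -biev_delta.
  transitivity (ev s * ev lcy * (ev P^`() * dfps (ev (num n j))) * F j
    + ev s * ev lcy * (ev P^`() * g') * ev (num n j) * F j.+1); first by rewrite /=; ring.
  by rewrite biev_deriv_root; ring.
rewrite {1}/S raddf_sum mulr_sumr.
under eq_bigr do rewrite Uder.
rewrite sumrB.
rewrite [X in _ - X - _]big_ord_recr /=.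
(* L(f) = 0 at g expresses l(g) f^(m+1)(g) by lower derivatives; this is why [lcy] is a factor of
   [denom]. *)
have Em : ev (s * lcy * derx P * num n m) * F m.+1 =
    - \sum_(j < m.+1) ev (s * derx P * map_poly polyC L`_j * num n m) * F j.
  move/eqP: op_sol_comp; rewrite big_ord_recr /= addrC addr_eq0 => /eqP E.
  rewrite !bievM -/lcy in E *.
  transitivity (ev s * ev (derx P) * ev (num n m) * (ev lcy * F m.+1)).
    by rewrite /=; ring.
  rewrite E mulrN mulr_sumr; congr (- _); apply: eq_bigr => j _.
  by rewrite !bievM; ring.
rewrite [F m.+1]/= in Em; rewrite Em.
have Esh : \sum_(j < m) ev (s * lcy * derx P * num n j) * F j.+1 =
   \sum_(j < m.+1) ev (if val j is j'.+1 then s * lcy * derx P * num n j' else 0) * F j.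
  by rewrite [RHS]big_ord_recl /= biev0 mul0r add0r; apply: eq_bigr.
rewrite [X in _ - (X + _) - _]Esh /S mulr_sumr -sumrMnl opprD opprK.
rewrite addrA -sumrB -big_split -sumrB; apply: eq_bigr => j _ /=.
rewrite [in RHS]bievD [in RHS]bievB [in RHS]bievB bievMn.
by rewrite [ev (ddenom * _)]bievM; ring.
Qed.

End Numerators.

(** * Bidegree bounds and pseudo-division *)

Section BiDegree.
Variable C : fieldType.
Implicit Types P Q : {poly {poly C}}.

(* [m] bounds the degree in [x], but [n] bounds the size in [y] (degree plus one). *)
Definition bidle (m n : nat) Q : Prop :=
  (size Q <= n)%N /\ forall i, (size (Q`_i)%R <= m.+1)%N.

Lemma size_sum_leq (I : Type) (r : seq I) (F : I -> {poly C}) n :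
  (forall i, (size (F i) <= n)%N) -> (size (\sum_(i <- r) F i)%R <= n)%N.
Proof.
move=> szF; elim/big_rec: _ => [|i p _ szp]; first by rewrite size_poly0.
by rewrite (leq_trans (size_polyD _ _)) // geq_max szF.
Qed.

Lemma bidleW m n m' n' Q :
  (m <= m')%N -> (n <= n')%N -> bidle m n Q -> bidle m' n' Q.
Proof. by move=> lem len [szQ dQ]; split=> [|i]; [|have := dQ i]; lia. Qed.

Lemma bidle0 m n : bidle m n 0.
Proof. by split=> [|i]; rewrite ?coef0 size_poly0. Qed.

Lemma bidle1 : bidle 0 1 1.
Proof.
split=> [|i]; first by rewrite size_poly1.
by rewrite coef1; case: eqP; rewrite ?size_poly1 ?size_poly0.
Qed.

Lemma bidleD m n P Q : bidle m n P -> bidle m n Q -> bidle m n (P + Q).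
Proof.
move=> [szP dP] [szQ dQ]; split=> [|i].
  by rewrite (leq_trans (size_polyD _ _)) // geq_max szP.
by rewrite coefD (leq_trans (size_polyD _ _)) // geq_max dP dQ.
Qed.

Lemma bidleN m n Q : bidle m n Q -> bidle m n (- Q).
Proof. by move=> [szQ dQ]; split=> [|i]; rewrite ?coefN size_polyN. Qed.

Lemma bidleB m n P Q : bidle m n P -> bidle m n Q -> bidle m n (P - Q).
Proof. by move=> bP bQ; apply/bidleD/bidleN. Qed.

Lemma bidleMn m n Q k : bidle m n Q -> bidle m n (Q *+ k).
Proof.
by move=> bQ; elim: k => [|k IH]; [exact: bidle0 | rewrite mulrS; apply: bidleD].
Qed.

Lemma bidleM m1 n1 m2 n2 P Q :
  bidle m1 n1 P -> bidle m2 n2 Q -> bidle (m1 + m2) (n1 + n2).-1 (P * Q).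
Proof.
move=> [szP dP] [szQ dQ]; split=> [|i].
  by apply: leq_trans (size_polyMleq _ _) _; lia.
rewrite coefM; apply: size_sum_leq => j.
apply: leq_trans (size_polyMleq _ _) _.
by have := dP j; have := dQ (i - j)%N; lia.
Qed.

Lemma bidleX m n Q k : bidle m n.+1 Q -> bidle (k * m) (k * n).+1 (Q ^+ k).
Proof.
move=> bQ; elim: k => [|k IH]; first exact: bidle1.
by rewrite exprS; apply: bidleW (bidleM bQ IH); lia.
Qed.

Lemma bidle_deriv m n Q : bidle m n Q -> bidle m n.-1 Q^`().
Proof.
move=> [szQ dQ]; split=> [|i].
  by have [->|Q0] := eqVneq Q 0; [rewrite deriv0 size_poly0 | have := lt_size_deriv Q0; lia].
by rewrite coef_deriv -scaler_nat (leq_trans (size_scale_leq _ _)).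
Qed.

Lemma bidle_derx m n Q : bidle m n Q -> bidle m n (derx Q).
Proof.
move=> [szQ dQ]; split=> [|i]; first exact: leq_trans (size_poly _ _) szQ.
rewrite coef_map /=; have [->|Q0] := eqVneq Q`_i 0; first by rewrite deriv0 size_poly0.
exact: leq_trans (ltnW (lt_size_deriv Q0)) (dQ i).
Qed.

Lemma bidle_polyC n (q : {poly C}) :
  (size q <= n)%N -> bidle 0 n (map_poly polyC q).
Proof.
move=> szq; split=> [|i]; first exact: leq_trans (size_poly _ _) szq.
by rewrite coef_map /= size_polyC leq_b1.
Qed.

Lemma bidleC m (q : {poly C}) : (size q <= m.+1)%N -> bidle m 1 q%:P.
Proof.
move=> szq; split=> [|i]; first by rewrite size_polyC leq_b1.
by rewrite coefC; case: eqP => //; rewrite size_poly0.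
Qed.

Lemma bidle_Xn k : bidle 0 k.+1 'X^k.
Proof.
split=> [|i]; first by rewrite size_polyXn.
by rewrite coefXn; case: eqP; rewrite ?size_poly1 ?size_poly0.
Qed.

(** Each of the [k] pseudo-division steps lowers the y-size bound by one, at the cost of a factor
    [lead_coef P] and of [dP] in the x-degree bound. *)
Lemma pseudo_reduce P p dP : size P = p.+2 -> bidle dP p.+2 P ->
  forall k m Q, bidle m (p.+1 + k) Q -> exists E R,
    (lead_coef P)%:P ^+ k * Q = E * P + R /\ bidle (m + k * dP) p.+1 R.
Proof.
move=> szP bP; elim=> [|k IH] m Q bQ.
  exists 0, Q; rewrite mul1r mul0r add0r; split=> //.
  by apply: bidleW bQ; lia.
pose t := Q`_(p.+1 + k).
(* Both terms have the same coefficient at y^(p+1+k), so it cancels. *)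
pose Q1 := (lead_coef P)%:P * Q - t%:P * 'X^k * P.
have lcP : lead_coef P = P`_p.+1 by rewrite lead_coefE szP.
have bQ1 : bidle (m + dP) (p.+1 + k).+1 Q1.
  apply: bidleB.
    apply: bidleW (bidleM (@bidleC dP _ _) bQ); [by lia..|].
    by rewrite lcP; apply: bP.2.
  apply: bidleW (bidleM (bidleM (@bidleC m _ _) (bidle_Xn k)) bP); [by lia..|].
  exact: bQ.2.
have {}bQ1 : bidle (m + dP) (p.+1 + k) Q1.
  split; last exact: bQ1.2.
  apply/leq_sizeP => j; rewrite leq_eqVlt => /orP [/eqP <-|ltj]; last first.
    by have /leq_sizeP/(_ j ltj) := bQ1.1.
  rewrite coefB coefCM -mulrA coefCM coefXnM ifF; last by lia.
  by rewrite addnK lcP /t mulrC subrr.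
have [E [R [EQ bR]]] := IH _ _ bQ1.
exists (E + (lead_coef P)%:P ^+ k * t%:P * 'X^k), R; split; last first.
  by apply: bidleW bR; lia.
rewrite exprS mulrDl -addrA [_ + R]addrC addrA -EQ /Q1; ring.
Qed.

End BiDegree.

(** * Bidegrees of the numerators *)

Section NumeratorDegrees.
Variables (C : fieldType) (P L s T : {poly {poly C}}) (m p dP dL sx sy : nat).
Hypothesis bP : bidle dP p.+2 P.
Hypothesis bs : bidle sx sy.+1 s.
Hypothesis bT : bidle (sx + dP) (sy + p).+1 T.
Hypothesis bL : forall k, (size (L`_k)%R <= dL.+1)%N.

Lemma bidle_delta k n Q :
  bidle k n.+1 Q -> bidle (k + dP) (n + p.+1) (delta P Q).
Proof.
move=> bQ; apply: bidleB.
  by apply: bidleW (bidleM (bidle_derx bQ) (bidle_deriv bP)); lia.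
by apply: bidleW (bidleM (bidle_deriv bQ) (bidle_derx bP)); lia.
Qed.

Lemma bidle_lcy : bidle 0 dL.+1 (lcy L m).
Proof. exact: bidle_polyC. Qed.

Lemma bidle_denom : bidle (sx + dP) (sy + p + dL).+1 (denom P L s m).
Proof.
by apply: bidleW (bidleM (bidleM (bidle_deriv bP) bs) bidle_lcy); lia.
Qed.

Lemma bidle_ddenom : bidle (sx + dP) (sy + p + dL).+1 (ddenom P L s T m).
Proof.
apply: bidleB; first by apply: bidleW (bidleM bT bidle_lcy); lia.
by apply: bidleW (bidleM (bidleM bs (bidle_derx bP)) (bidle_deriv bidle_lcy)); lia.
Qed.

(** Each derivative costs the bidegree of [denom], plus one in y: P_x has y-degree up to [p.+1],
    against [p] for P_y. *)
Lemma bidle_num n j :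
  bidle (n * (sx + dP)) (n * (sy + p + dL).+1).+1 (num P L s T m n j).
Proof.
elim: n j => [|n IH] j.
  by case: j => [|j]; [exact: bidle1 | exact: bidle0].
rewrite !mulSn /=; move: (n * _)%N (n * _)%N IH => x y IH.
apply: bidleD; first (apply: bidleB; first apply: bidleB).
- by apply: bidleW (bidleM (bidleM bs bidle_lcy) (bidle_delta (IH j))); lia.
- by apply: bidleMn; apply: bidleW (bidleM bidle_ddenom (IH j)); lia.
- case: j => [|j]; first exact: bidle0.
  by apply: bidleW (bidleM (bidleM (bidleM bs bidle_lcy) (bidle_derx bP)) (IH j)); lia.
apply: bidleW (bidleM (bidleM (bidleM bs (bidle_derx bP))
  (bidle_polyC (bL j))) (IH m)); lia.
Qed.

End NumeratorDegrees.

(** * Underdetermined linear systems with polynomial unknowns *)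

Section LinearSystem.
Variables (C : fieldType) (p q d A : nat) (B : 'I_p -> 'I_q -> {poly C}).

Definition syst (X : 'M[C]_(p, d.+1)) : 'M[C]_(q, d + A.+1) :=
  \matrix_(e, t) (\sum_(l < p) rVpoly (row l X) * B l e)`_t.

Fact syst_linear : linear syst.
Proof.
move=> c X Y; apply/matrixP => e t; rewrite !mxE.
have -> : \sum_(l < p) rVpoly (row l (c *: X + Y)) * B l e =
    c *: (\sum_(l < p) rVpoly (row l X) * B l e) + \sum_(l < p) rVpoly (row l Y) * B l e.
  rewrite scaler_sumr -big_split; apply: eq_bigr => l _ /=.
  by rewrite linearP linearP /= mulrDl scalerAl.
by rewrite coefD coefZ.
Qed.

HB.instance Definition _ :=
  GRing.isLinear.Build C 'M[C]_(p, d.+1) 'M[C]_(q, d + A.+1) _ syst syst_linear.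

(** Over C there are p (d+1) unknown coefficients and q (d+A+1) equations, so [syst] has a
    non-trivial kernel. *)
Lemma poly_system_solution :
  (forall l e, (size (B l e) <= A.+1)%N) -> (q * (d + A.+1) < p * d.+1)%N ->
  exists c : 'I_p -> {poly C}, [/\ exists l, c l != 0,
    forall l, (size (c l) <= d.+1)%N & forall e, \sum_(l < p) c l * B l e = 0].
Proof.
move=> szB ltqp.
have : kermx (lin_mx syst) != 0.
  rewrite -mxrank_eq0 mxrank_ker subn_eq0 -ltnNge.
  exact: leq_ltn_trans (rank_leq_col _) ltqp.
case/rowV0Pn => v /sub_kermxP vK v0; pose X : 'M_(p, d.+1) := vec_mx v.
have X0 : syst X = 0.
  by apply/eqP; rewrite -mxvec_eq0 -mul_vec_lin vec_mxK vK.
exists (fun l => rVpoly (row l X)); split=> [|l|e].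
- apply: contrapT => /forallNP H; move/eqP: v0; apply.
  rewrite -[v]vec_mxK -/X; suff -> : X = 0 by rewrite linear0.
  apply/row_matrixP => l; rewrite row0 -[LHS]rVpolyK.
  by have /negP/negPn/eqP -> := H l; rewrite linear0.
- exact: size_poly.
have szS : (size (\sum_(l < p) rVpoly (row l X) * B l e)%R <= d + A.+1)%N.
  apply: size_sum_leq => l; apply: leq_trans (size_polyMleq _ _) _.
  by have := szB l e; have : (size (rVpoly (row l X)) <= d.+1)%N by [apply: size_poly]; lia.
apply/polyP => t; rewrite coef0; case: (ltnP t (d + A.+1)) => [ltt|]; last first.
  by move/leq_sizeP: szS; apply.
by have := congr1 (fun M : 'M_(_, _) => M e (Ordinal ltt)) X0; rewrite !mxE.
Qed.

End LinearSystem.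

(** * Non-vanishing along a root, in characteristic zero *)

Lemma deriv_neq0_char0 (R : idomainType) (p : {poly R}) :
  [pchar R] =i pred0 -> (1 < size p)%N -> p^`() != 0.
Proof.
move=> /pcharf0P charR szp; apply/eqP => /polyP /(_ (size p).-2) /eqP.
rewrite coef0 coef_deriv (_ : (size p).-2.+1 = (size p).-1); last by lia.
rewrite -lead_coefE -mulr_natr mulf_eq0 lead_coef_eq0 -size_poly_eq0 charR; lia.
Qed.

Section NonVanishing.
Variable C : fieldType.
Hypothesis charC0 : [pchar C] =i pred0.
Implicit Types (P : {poly {poly C}}) (g : fps C).

(** Differentiating q(g) = 0 gives q'(g) g' = 0: either [g] is constant, or the induction continues
    with q', non-zero of lower degree. *)
Lemma fps_root_constant (q : {poly C}) g :
  q != 0 -> (map_poly (@cst C) q).[g] = 0 -> g = cst (g 0%N).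
Proof.
have [n] := ubnP (size q); elim: n => // n IH in q *; rewrite ltnS => szq q0 qg0.
have [szq1|szq1] := leqP (size q) 1.
  rewrite (size1_polyC szq1) map_polyC hornerC in qg0.
  have c0 : q`_0 = 0 := congr1 (fun f : fps C => f 0%N) qg0.
  by move: q0; rewrite (size1_polyC szq1) c0 eqxx.
have := dfps_horner (map_poly (@cst C) q) g.
have -> : map_poly (@dfps C) (map_poly (@cst C) q) = 0.
  by apply/polyP => i; rewrite !coef_map /= dfps_cst coef0.
rewrite qg0 raddf0 horner0 add0r deriv_map => /esym /fps_mulf_eq0 [|].
  apply: IH; last exact: deriv_neq0_char0.
  exact: leq_trans (lt_size_deriv q0) szq.
exact: dfps_eq0.
Qed.

Lemma biev_polyC_neq0 (K : closedFieldType) (iota : {rmorphism C -> K}) P a g (q : {poly C}) :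
  no_y_divisor iota P -> biev a g P = 0 -> q != 0 ->
  biev a g (map_poly polyC q) != 0.
Proof.
move=> hnoy Pg0 q0; apply/eqP; rewrite biev_polyC => /(fps_root_constant q0) gE.
set c := g 0%N in gE.
have : root P c%:P.
  apply/rootP; apply: (@fps_of_poly_inj _ a); rewrite -[RHS]Pg0 /biev.
  by rewrite -horner_map /= fps_of_polyC -gE.
case/factor_theorem => R PE.
have : (size ('X - (iota c)%:P)%R <= 1)%N.
  apply: (hnoy _ (map_poly (map_poly iota) R)).
  rewrite PE rmorphM mulrC; congr (_ * _); rewrite !rmorphB /= !map_polyX !map_polyC /=.
  by rewrite map_polyC.
by rewrite size_XsubC.
Qed.

(** If u v divides P over C(x), so does gcd(u, v)^2, which forces the gcd to be constant; the
    condition on derivatives holds by characteristic zero. *)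
Lemma squarefree_separable P :
  squarefree_Cx P -> P != 0 -> separable_poly (map_poly (@tofrac {poly C}) P).
Proof.
move=> sqfP P0.
have charF : [pchar {fraction {poly C}}] =i pred0.
  apply/pcharf0P => n; rewrite -(rmorph_nat (@tofrac {poly C})) tofrac_eq0.
  by rewrite -polyC_natr polyC_eq0; move/pcharf0P: charC0.
apply/separable_polyP; split=> [u v uvP|u uP]; last exact: deriv_neq0_char0.
have PF0 : map_poly (@tofrac {poly C}) P != 0.
  by rewrite map_poly_eq0_id0 // tofrac_eq0 lead_coef_eq0.
have uv0 : u * v != 0 by apply: contraNneq PF0 => uv0; rewrite uv0 dvd0p in uvP.
have gg : gcdp u v * gcdp u v %| map_poly (@tofrac {poly C}) P.
  by apply: dvdp_trans uvP; apply: dvdp_mul; [apply: dvdp_gcdl | apply: dvdp_gcdr].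
rewrite coprimep_def eqn_leq; apply/andP; split.
  by apply: (sqfP _ (map_poly (@tofrac {poly C}) P %/ (gcdp u v * gcdp u v)));
     rewrite mulrC divpK.
rewrite lt0n size_poly_eq0 gcdp_eq0; apply: contraNN uv0.
by case/andP => /eqP -> _; rewrite mul0r.
Qed.

(** The resultant in y of P and P_y lies in the ideal they generate and is a non-zero polynomial in
    x, so both cannot vanish at [g]. *)
Lemma biev_deriv_neq0 P a g p : size P = p.+2 -> squarefree_Cx P ->
  biev a g P = 0 -> biev a g P^`() != 0.
Proof.
move=> szP sqfP Pg0; have P0 : P != 0 by rewrite -size_poly_eq0 szP.
have charPC : [pchar {poly C}] =i pred0.
  apply/pcharf0P => n.
  by rewrite -polyC_natr polyC_eq0; move/pcharf0P: charC0.
have dP0 : P^`() != 0 by apply: deriv_neq0_char0; rewrite ?szP.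
(* The resultant identity requires positive y-degree; a P_y free of y is itself a non-zero
   polynomial in x. *)
have [szdP|szdP] := leqP (size P^`()) 1.
  move: dP0; rewrite (size1_polyC szdP) bievC; apply: contraNneq.
  by move/fps_of_poly_inj ->.
have szP1 : (1 < size P)%N by rewrite szP.
have [[u v] _ /= resE] := resultant_in_ideal szP1 szdP.
have res0 : resultant P P^`() != 0.
  rewrite -tofrac_eq0 map_resultant ?tofrac_eq0 ?lead_coef_eq0 //.
  rewrite resultant_eq0 -leqNgt -deriv_map.
  have := squarefree_separable sqfP P0.
  by rewrite separable_poly.unlock coprimep_def => /eqP ->.
apply: contraNneq res0 => dPg0; apply/eqP/(@fps_of_poly_inj _ a).
by rewrite -(bievC a g) resE bievD !bievM Pg0 dPg0 !mulr0 addr0.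
Qed.

End NonVanishing.

(* [T] is the derivative of [P_y * s] along a root of [P]. For [deg_y P >= 2],
   [s = P_y] clears the denominator of that derivative; for [deg_y P = 1],
   [P_y] is free of [y], and the choice [s = 1] saves the degree in [x] needed
   for the bound. *)
Lemma denominator_factor (C : fieldType) (P : {poly {poly C}}) (p dP : nat) :
  bidle dP p.+2 P ->
  exists s T sx sy, [/\ bidle sx sy.+1 s, bidle (sx + dP) (sy + p).+1 T,
    (sx + sy * dP <= 2 * p * dP)%N,
    forall a g, biev a g P = 0 -> biev a g T = dfps (biev a g (P^`() * s)) &
    forall a g, biev a g P^`() != 0 -> biev a g s != 0].
Proof.
move=> bP; case: p bP => [|p] bP.
  exists 1, (derx P^`()), 0%N, 0%N; split=> [|||a g Pg0|a g _].
  - exact: bidle1.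
  - by apply: bidle_derx; apply: bidleW (bidle_deriv bP).
  - by [].
  - rewrite mulr1 dfps_biev.
    have /size1_polyC -> : (size P^`()^`() <= 1)%N.
      by apply: leq_trans (bidle_deriv (bidle_deriv bP)).1 _.
    have -> : P^`()^`()`_0 = 0.
      by apply/(leq_sizeP _ 0%N) => //; apply: (bidle_deriv (bidle_deriv bP)).1.
    by rewrite bievC raddf0 mul0r addr0.
  - by rewrite biev1 oner_neq0.
exists P^`(), (delta P P^`() *+ 2), dP, p.+1; split=> [|||a g Pg0|//].
- exact: bidle_deriv bP.
- by apply: bidleMn; apply: bidleW (bidle_delta bP (bidle_deriv bP)); lia.
- nia.
rewrite bievMn -(biev_delta Pg0) bievM dfpsM; ring.
Qed.

(** * Construction of the annihilating operator *)

Section Annihilator.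
Variable C : fieldType.
Implicit Types P L M : {poly {poly C}}.

Definition composition_annihilator P L r d M : Prop :=
  [/\ M != 0, (op_order M <= r)%N, (op_degree M <= d)%N &
    forall (a : C) (g : series C), is_alg_sol P a g ->
    forall f : series C, is_op_sol L (g 0%N) f -> is_op_sol M a (ps_comp f g)].

Lemma is_alg_solE P a (g : fps C) : is_alg_sol P a g -> biev a g P = 0.
Proof. by move=> Pg0; rewrite -eval_bivarE; apply: fpsP. Qed.

(** Serves the degenerate cases r_L = 0, where l_0 f = 0 forces f = 0, and r_P = 0, where P has no
    solution. *)
Lemma one_annihilator P L r d :
  (forall (a : C) (g : fps C), is_alg_sol P a g ->
   forall f : fps C, is_op_sol L (g 0%N) f -> comp_fps f g = 0) ->
  composition_annihilator P L r d 1.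
Proof.
move=> comp0; split; rewrite ?oner_neq0 /op_order /op_degree ?size_poly1 //.
  by rewrite big_ord_recl big_ord0 coef1 /= size_poly1.
move=> a g Pg f Lf n.
rewrite apply_opE size_poly1 big_ord_recl big_ord0 addr0 /=.
by rewrite -/(comp_fps f g) (comp0 a g Pg f Lf) mulr0.
Qed.

Lemma order0_annihilator P L r d :
  size L = 1%N -> composition_annihilator P L r d 1.
Proof.
move=> szL; apply: one_annihilator => a g _ f Lf.
have Lf0 : apply_op L (g 0%N) f = 0 :> fps C by apply: fpsP.
rewrite apply_opE szL big_ord_recl big_ord0 addr0 /= in Lf0.
have [/fps_of_poly_inj L0|->] := fps_mulf_eq0 Lf0; last exact: comp_fps0.
have : L != 0 by rewrite -size_poly_eq0 szL.
by rewrite -lead_coef_eq0 lead_coefE szL L0 eqxx.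
Qed.

Lemma degy0_annihilator P L r d :
  size P = 1%N -> composition_annihilator P L r d 1.
Proof.
move=> szP; apply: one_annihilator => a g /is_alg_solE Pg0.
have PE : P = (P`_0)%:P by apply: size1_polyC; rewrite szP.
rewrite PE bievC in Pg0; have P0 := fps_of_poly_inj Pg0.
by have := szP; rewrite PE P0 size_poly0.
Qed.

Lemma annihilator_exists (K : closedFieldType) (iota : {rmorphism C -> K})
    P L (m p dP dL r d : nat) :
  [pchar C] =i pred0 -> squarefree_Cx P -> no_y_divisor iota P ->
  size L = m.+2 -> (forall k, (size (L`_k)%R <= dL.+1)%N) ->
  size P = p.+2 -> bidle dP p.+2 P ->
  (m.+1 * p.+1 * (d + (r * (3 * p + 2 + dL) * dP).+1) < r.+1 * d.+1)%N ->
  exists M, composition_annihilator P L r d M.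
Proof.
move=> charC0 sqfP hnoy szL bL szP bP; set A := (r * _ * dP)%N => ltA.
have [s [T [sx [sy [bs bT le_s evT s_neq0]]]]] := denominator_factor bP.
pose q := num P L s T m; pose U := denom P L s m.
(* In y, every [q n j * U ^+ (r - n)] has degree at most [k], so [k] pseudo-division steps
   suffice. *)
pose k := (r * (sy + p + dL).+1)%N.
have /fin_all_exists [R RP] (x : 'I_r.+1 * 'I_m.+1) : exists R,
    (exists E, (lead_coef P)%:P ^+ k * (q x.1 x.2 * U ^+ (r - x.1)) = E * P + R)
    /\ bidle A p.+1 R.
  case: x => n j /=; have len : (n <= r)%N by rewrite -ltnS.
  have bQ : bidle (r * (sx + dP)) (p.+1 + k) (q n j * U ^+ (r - n)).
    have := bidleM (bidle_num m bP bs bT bL n j) (bidleX (r - n) (bidle_denom m bP bs bL)).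
    by apply: bidleW; rewrite /k; nia.
  have [E [R [ER bR]]] := pseudo_reduce szP bP bQ.
  exists R; split; first by exists E.
  (* The x-degree is at most r (sx + dP) + k dP = r (sx + sy dP + (p + dL + 2) dP), and sx + sy dP
     is at most 2 p dP. *)
  by apply: bidleW bR; rewrite // /A /k; nia.
(* One equation for each pair of a derivative f^(j) o g and a power y^i, with i at most [p]. *)
pose I := ('I_m.+1 * 'I_p.+1)%type.
pose B (n : 'I_r.+1) (e : 'I_#|{: I}|) := (R (n, (enum_val e).1))`_(enum_val e).2.
have [||c [[n0 cn0] szc cB]] := @poly_system_solution _ _ _ d A B.
- by move=> n e; apply: (RP _).2.2.
- by rewrite card_prod !card_ord.
have cR j : \sum_(n < r.+1) (c n)%:P * R (n, j) = 0.
  apply/polyP => i; rewrite coef0 coef_sum.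
  case: (ltnP i p.+1) => [lti|lei]; last first.
    rewrite big1 // => n _; rewrite coefCM.
    by have /leq_sizeP -> := (RP (n, j)).2.1; rewrite ?mulr0.
  rewrite -[RHS](cB (enum_rank (j, Ordinal lti))); apply: eq_bigr => n _.
  by rewrite coefCM /B enum_rankK.
pose M := \poly_(i < r.+1) c (inord i).
have ME (n : 'I_r.+1) : M`_n = c n by rewrite coef_poly ltn_ord inord_val.
have szM : (size M <= r.+1)%N by apply: size_poly.
exists M; split.
- by apply: contraNneq cn0 => M0; rewrite -ME M0 coef0.
- by move: szM; rewrite /op_order; case: (size M).
- apply/bigmax_leqP => i _; have lti : (i < r.+1)%N by apply: leq_trans szM.
  by have := szc (Ordinal lti); rewrite -ME /=; case: (size _).
move=> a g /is_alg_solE Pg0 f Lf; pose h := comp_fps f g.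
suff /(congr1 (fun f : fps C => f _)) Mh0 : apply_op M a h = 0 :> fps C.
  by move=> n; apply: Mh0.
have -> : apply_op M a h =
    \sum_(n < r.+1) fps_of_poly a (c n) * iter n (@dfps C) h :> fps C.
  rewrite apply_opE (big_ord_widen _ (fun n => fps_of_poly a M`_n * iter n (@dfps C) h) szM).
  rewrite big_mkcond; apply: eq_bigr => n _ /=; rewrite -ME.
  by case: ltnP => // /leq_sizeP -> //; rewrite raddf0 mul0r.
set S := \sum_(n < _) _.
have lc0 : fps_of_poly a (lead_coef P) != 0.
  apply/eqP => /fps_of_poly_inj /eqP; apply/negP.
  by rewrite lead_coef_eq0 -size_poly_eq0 szP.
have U0 : biev a g U != 0.
  rewrite /U /denom !bievM; apply/eqP => /fps_mulf_eq0 [/fps_mulf_eq0 [] |] /eqP; apply/negP.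
  - exact: biev_deriv_neq0 szP sqfP Pg0.
  - exact/s_neq0/(biev_deriv_neq0 charC0 szP sqfP Pg0).
  apply: biev_polyC_neq0 hnoy Pg0 _ => //.
  have : lead_coef L != 0 by rewrite lead_coef_eq0 -size_poly_eq0 szL.
  by rewrite lead_coefE szL.
(* Series form a domain, so [S] may be multiplied by the non-zero factor that clears all
   denominators. *)
suff : fps_of_poly a (lead_coef P) ^+ k * biev a g U ^+ r * S = 0.
  case/fps_mulf_eq0 => // /fps_mulf_eq0 [] /eqP H; exfalso; move: H; apply/negP;
    exact: fps_exp_neq0.
pose F j := comp_fps (iter j (@dfps C) f) g.
(* U^r splits as U^(r-n) U^n: the factor U^n clears the [n]-th derivative, and the multiple [E * P]
   from the reduction vanishes at [g]. *)
have term (n : 'I_r.+1) : fps_of_poly a (lead_coef P) ^+ k * biev a g U ^+ r *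
    (fps_of_poly a (c n) * iter n (@dfps C) h) =
    \sum_(j < m.+1) biev a g ((c n)%:P * R (n, j)) * F j.
  have len : (n <= r)%N by rewrite -ltnS.
  have -> : biev a g U ^+ r = biev a g U ^+ (r - n) * biev a g U ^+ n.
    by rewrite -exprD subnK.
  transitivity (fps_of_poly a (c n) * fps_of_poly a (lead_coef P) ^+ k
    * biev a g U ^+ (r - n) * (biev a g U ^+ n * iter n (@dfps C) h)); first by ring.
  rewrite (denom_iter_deriv Pg0 Lf szL (evT a g Pg0)) mulr_sumr.
  apply: eq_bigr => j _; have [[E ER] _] := RP (n, j).
  have -> : biev a g ((c n)%:P * R (n, j)) = fps_of_poly a (c n) *
      biev a g ((lead_coef P)%:P ^+ k * (q n j * U ^+ (r - n))).
    by rewrite /= in ER; rewrite ER bievD [in RHS]bievM Pg0 mulr0 add0r bievM bievC.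
  rewrite bievM [biev a g (q n j * _)]bievM !bievX bievC -/(q n j) -/U -/(F j); ring.
rewrite /S mulr_sumr; under eq_bigr do rewrite term.
rewrite exchange_big big1 //= => j _; rewrite -mulr_suml.
rewrite [X in X * _](_ : _ = biev a g (\sum_(n < r.+1) (c n)%:P * R (n, j))).
  by rewrite cR biev0 mul0r.
by elim/big_rec2: _ => [|n x y _ ->]; rewrite ?biev0 // [in RHS]bievD.
Qed.

End Annihilator.

Theorem theorem3
  (C : fieldType) (charC0 : [pchar C] =i pred0)
  (K : closedFieldType) (iota : {rmorphism C -> K})
  (Kclos : is_alg_closure iota)
  (L : {poly {poly C}}) (rL dL : nat)
  (hordL : size L = rL.+1)
  (hdegL : forall k, (size (L`_k)%R <= dL.+1)%N)
  (P : {poly {poly C}}) (rP dP : nat)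
  (hdegyP : size P = rP.+1) (hdegxP : degx P = dP)
  (hsqf : squarefree_Cx P) (hnoy : no_y_divisor iota P)
  (r d : nat)
  (hr : (rL * rP <= r)%N)
  (hd : (d%:R : rat) >=
        (r%:R * (3 * rP%:R + dL%:R - 1) * dP%:R * rL%:R * rP%:R)
          / (r%:R + 1 - (rL * rP)%:R)) :
  (exists M : {poly {poly C}},
     [/\ M != 0, (op_order M <= r)%N, (op_degree M <= d)%N &
       forall (a : C) (g : series C), is_alg_sol P a g ->
       forall f : series C, is_op_sol L (g 0%N) f ->
         is_op_sol M a (ps_comp f g)])
  /\
  (exists M : {poly {poly C}},
     [/\ M != 0, (op_order M <= rL * rP)%N,
         (op_degree M <= (3 * rP + dL - 1) * dP * rL ^ 2 * rP ^ 2)%N &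
       forall (a : C) (g : series C), is_alg_sol P a g ->
       forall f : series C, is_op_sol L (g 0%N) f ->
         is_op_sol M a (ps_comp f g)]).
Proof.
have bP p : rP = p.+1 -> bidle dP p.+2 P.
  move=> rPE; split=> [|j]; first by rewrite hdegyP rPE.
  have [ltj|lej] := ltnP j (size P); last by rewrite nth_default ?size_poly0.
  have := @leq_bigmax _ (fun j : 'I_(size P) => (size (P`_j)%R).-1) (Ordinal ltj).
  by rewrite -/(degx P) hdegxP /=; lia.
(* Both claims are instances of this form, where the degree bound is cleared of its denominator. *)
have annihilator r' d' : (rL * rP <= r')%N ->
    (r' * (3 * rP + dL - 1) * dP * rL * rP <= d' * (r'.+1 - rL * rP))%N ->
    exists M, composition_annihilator P L r' d' M.
  move=> {hr hd} ler led.
  case: rL hordL ler led => [|m] szL ler led.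
    by exists 1; apply: order0_annihilator.
  case: rP hdegyP bP ler led => [|p] szP bP' ler led.
    by exists 1; apply: degy0_annihilator.
  apply: (annihilator_exists charC0 hsqf hnoy szL hdegL szP (bP' p erefl)).
  have E3 : (3 * p.+1 + dL - 1 = 3 * p + 2 + dL)%N by lia.
  rewrite {}E3 in led.
  (* With b = r_L r_P, (r'+1)(d'+1) - b(d'+A+1) = (r'+1-b)(d'+1) - bA, which is at least r'+1-b >
     0. *)
  move: led ler; rewrite -(mulnA _ m.+1) (mulnC _ (m.+1 * p.+1)%N).
  move: (m.+1 * p.+1)%N (r' * _ * _)%N => b A; nia.
split; first apply: annihilator => //.
  (* Once r_P is positive, the natural subtraction in [3 * rP + dL - 1] is not truncated and agrees
     with the rational one. *)
  case: (posnP rP) => [->|rP0]; first by rewrite muln0.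
  rewrite -(ler_nat rat) [leRHS]natrM [in leRHS]natrB; last by lia.
  rewrite ler_pdivrMr in hd; last by rewrite subr_gt0 natr1 ltr_nat.
  rewrite -[in leRHS]natr1; apply: le_trans hd.
  rewrite !natrM natrB; last by lia.
  by rewrite natrD natrM.
(* For r = r_L r_P the denominator r + 1 - r_L r_P is 1. *)
have [M MP] := annihilator (rL * rP)%N
  ((3 * rP + dL - 1) * dP * rL ^ 2 * rP ^ 2)%N (leqnn _) ltac:(nia).
by exists M.
Qed.
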